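(* Let $G=\mathrm{U}(1)\ltimes\mathbb{C}$ act on $\mathbb{C}$ by $[a,b]\cdot z=az+b$, let $\rho:G\to G$ be a group endomorphism, and define $$\Xi_\rho:=\{\beta\in\mathbb{C}\ :\ G_\beta\supset\rho(G_0)\},\qquad\text{where } G_x:=\{g\in G\ :\ g\cdot x=x\}.$$ Then a mapping $\tau:\mathbb{C}\to\mathbb{C}$ satisfies $$\tau(g\cdot z)=\rho(g)\cdot\tau(z)\quad\text{for all } g\in G,\ z\in\mathbb{C}$$ if and only if there exists $\beta\in\Xi_\rho$ such that $$\tau(z)=\rho([1,z])\cdot\beta\quad\text{for all } z\in\mathbb{C}$$ (in which case $\tau(0)=\beta$).
   Context: $G=\mathrm{U}(1)\ltimes\mathbb{C}$ is the group of matrices $[a,b]:=\begin{pmatrix}a&b\\0&1\end{pmatrix}$ with $a\in\mathbb{C}$, $|a|=1$, and $b\in\mathbb{C}$, so that $[a,b][a',b']=[aa',ab'+b]$. It acts transitively on $\mathbb{C}$ by $[a,b]\cdot z=az+b$. No regularity is assumed on $\rho$ or $\tau$. *)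

(* Defs.v *)
From HB Require Import structures.
From mathcomp Require Import all_boot all_order all_algebra.
From mathcomp Require Import complex.
From mathcomp Require Import boolp classical_sets reals.

Set Implicit Arguments.
Unset Strict Implicit.
Unset Printing Implicit Defensive.

Import Order.TTheory GRing.Theory Num.Theory.

Local Open Scope classical_set_scope.
Local Open Scope ring_scope.

Section AffineGroup.
Variable R : realType.
Local Notation C := R[i].

Definition affmx (a b : C) : 'M[C]_2 :=
  \matrix_(i < 2, j < 2) (nth [::] [:: [:: a; b]; [:: 0; 1]] i)`_j.

Lemma affmxE (a b : C) :
  [/\ affmx a b 0 0 = a, affmx a b 0 1 = b,
      affmx a b 1 0 = 0 & affmx a b 1 1 = 1].
Proof. by rewrite !mxE. Qed.

Lemma affmxM (a b a' b' : C) :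
  affmx a b *m affmx a' b' = affmx (a * a') (a * b' + b).
Proof.
apply/matrixP => -[[|[|//]] i] [[|[|//]] j]; rewrite !mxE !big_ord_recl big_ord0;
  by rewrite !mxE /= ?(mulr0, mulr1, mul0r, mul1r, addr0, add0r).
Qed.

Lemma affmx1 : affmx 1 0 = 1%:M.
Proof. by apply/matrixP => -[[|[|//]] i] [[|[|//]] j]; rewrite !mxE. Qed.

(* M is a matrix [a, b] with |a| = 1: the candidates for a and b can only be
   the entries of the first row of M. *)
Definition is_U1C : pred 'M[C]_2 :=
  fun M => (`|M 0 0| == 1) && (M == affmx (M 0 0) (M 0 1)).

Record U1C : Type := MkU1C { U1C_mx :> 'M[C]_2 ; U1C_mxP : is_U1C U1C_mx }.

HB.instance Definition _ := [isSub for U1C_mx].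
HB.instance Definition _ := [Choice of U1C by <:].

Lemma affmxP (a b : C) : `|a| = 1 -> is_U1C (affmx a b).
Proof.
by move=> a1; rewrite /is_U1C; have [-> -> _ _] := affmxE a b; rewrite a1 !eqxx.
Qed.

(* The group element [a, b]; the proof that |a| = 1 is its last argument. *)
Definition aff (a b : C) (a1 : `|a| = 1) : U1C := MkU1C (affmxP b a1).

(* [1, z], i.e. the translation by z. *)
Definition transl (z : C) : U1C := aff z (normr1 C).

Lemma U1CP (g : U1C) : `|g 0 0| = 1 /\ g = affmx (g 0 0) (g 0 1) :> 'M_2.
Proof. by case: g => M /= /andP[/eqP ? /eqP ?]. Qed.

Lemma U1C_mulP (g h : U1C) : is_U1C (g *m h).
Proof.
have [g1 ->] := U1CP g; have [h1 ->] := U1CP h.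
by rewrite affmxM; apply: affmxP; rewrite normrM g1 h1 mulr1.
Qed.

Lemma U1C_oneP : is_U1C 1%:M.
Proof. by rewrite -affmx1; apply/affmxP/normr1. Qed.

Lemma U1C_mulVmx (g : U1C) :
  affmx (g 0 0)^-1 (- ((g 0 0)^-1 * g 0 1)) *m g = 1%:M.
Proof.
have [g1 gE] := U1CP g.
have g0 : g 0 0 != 0 by rewrite -normr_gt0 g1 ltr01.
by rewrite [in X in _ *m X]gE affmxM mulVf // subrr affmx1.
Qed.

Lemma U1C_unitmx (g : U1C) : (g : 'M_2) \in unitmx.
Proof. by have [] := mulmx1_unit (U1C_mulVmx g). Qed.

Lemma U1C_invmx (g : U1C) :
  invmx g = affmx (g 0 0)^-1 (- ((g 0 0)^-1 * g 0 1)).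
Proof.
by rewrite -[RHS]mulmx1 -(mulmxV (U1C_unitmx g)) mulmxA U1C_mulVmx mul1mx.
Qed.

Lemma U1C_invP (g : U1C) : is_U1C (invmx g).
Proof.
by rewrite U1C_invmx; apply: affmxP; rewrite normfV (U1CP g).1 invr1.
Qed.

Definition U1C_mul (g h : U1C) : U1C := MkU1C (U1C_mulP g h).
Definition U1C_one : U1C := MkU1C U1C_oneP.
Definition U1C_inv (g : U1C) : U1C := MkU1C (U1C_invP g).

Lemma U1C_mulA : associative U1C_mul.
Proof. by move=> f g h; apply: val_inj; rewrite /= mulmxA. Qed.
Lemma U1C_mul1g : left_id U1C_one U1C_mul.
Proof. by move=> g; apply: val_inj; rewrite /= mul1mx. Qed.
Lemma U1C_mulg1 : right_id U1C_one U1C_mul.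
Proof. by move=> g; apply: val_inj; rewrite /= mulmx1. Qed.
Lemma U1C_mulVg : left_inverse U1C_one U1C_inv U1C_mul.
Proof. by move=> g; apply: val_inj; rewrite /= mulVmx ?U1C_unitmx. Qed.
Lemma U1C_mulgV : right_inverse U1C_one U1C_inv U1C_mul.
Proof. by move=> g; apply: val_inj; rewrite /= mulmxV ?U1C_unitmx. Qed.

HB.instance Definition _ := isGroup.Build U1C
  U1C_mulA U1C_mul1g U1C_mulg1 U1C_mulVg U1C_mulgV.

Lemma affM (a b a' b' : C) (a1 : `|a| = 1) (a1' : `|a'| = 1)
    (aa1 : `|a * a'| = 1) :
  (aff b a1 * aff b' a1')%g = aff (a * b' + b) aa1.
Proof. by apply: val_inj; rewrite /= affmxM. Qed.

(* [a, b] . z = a z + b, see act_aff. *)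
Definition act (g : U1C) (z : C) : C := g 0 0 * z + g 0 1.

Lemma act_aff (a b z : C) (a1 : `|a| = 1) : act (aff b a1) z = a * z + b.
Proof. by rewrite /act /=; have [-> -> _ _] := affmxE a b. Qed.

Lemma act1 (z : C) : act 1%g z = z.
Proof. by rewrite /act /= !mxE /= mul1r addr0. Qed.

Lemma actM (g h : U1C) (z : C) : act (g * h)%g z = act g (act h z).
Proof.
have [_ gE] := U1CP g; have [_ hE] := U1CP h.
have ghE : (g * h)%g = affmx (g 0 0 * h 0 0) (g 0 0 * h 0 1 + g 0 1) :> 'M_2.
  by rewrite -affmxM -gE -hE.
rewrite {1}/act ghE.
have [-> -> _ _] := affmxE (g 0 0 * h 0 0) (g 0 0 * h 0 1 + g 0 1).
by rewrite /act mulrDr mulrA addrA.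
Qed.

Definition stab (x : C) : set U1C := [set g | act g x = x].

Definition Xi (rho : U1C -> U1C) : set C :=
  [set beta | rho @` stab 0 `<=` stab beta].

End AffineGroup.

(* Main.v *)
(* Since the translation by z carries 0 to z, an equivariant map is determined
   by its value at 0, which must be fixed by the image of the stabilizer of 0.
   Conversely, for every g and z the elements g [1, z] and [1, g.z] both carry 0
   to g.z, hence differ by an element h of the stabilizer of 0, and rho h
   fixes beta. *)
Require Import Defs.
From mathcomp Require Import all_boot all_order all_algebra.
From mathcomp Require Import complex.
From mathcomp Require Import boolp classical_sets reals.

Local Open Scope classical_set_scope.
Local Open Scope ring_scope.

Lemma act_transl (R : realType) (z w : R[i]) : act (transl z) w = w + z.
Proof. by rewrite act_aff GRing.mul1r. Qed.

Lemma act_transl0 (R : realType) (z : R[i]) : act (transl z) 0 = z.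
Proof. by rewrite act_transl GRing.add0r. Qed.

Lemma XiP (R : realType) (rho : U1C R -> U1C R) (beta : R[i]) :
  Xi rho beta <-> forall g, act g 0 = 0 -> act (rho g) beta = beta.
Proof.
split=> [Xib g g0|Xib _ [g g0 <-]]; last exact: Xib.
by apply: Xib; exists g.
Qed.

(** The element [h^-1 * g] fixes 0, so its image under [rho] fixes [beta]. Hence [act (rho g) beta]
    depends only on the left coset of [g] modulo the stabilizer of 0. *)
Lemma act_eq_Xi (R : realType) (rho : UMagmaMorphism.type (U1C R) (U1C R))
    (beta : R[i]) (g h : U1C R) :
  Xi rho beta -> act g 0 = act h 0 -> act (rho g) beta = act (rho h) beta.
Proof.
move=> /XiP Xib gh0.
have hg0 : act (h^-1 * g)%g 0 = 0 by rewrite actM gh0 -actM mulVg act1.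
(* The [beta] on the right is first expanded to its image under [rho (h^-1 * g)]; then [h]
   cancels. *)
by rewrite -[in RHS](Xib _ hg0) -actM -gmulfM mulgA mulgV mul1g.
Qed.

Theorem theorem2p2 (R : realType)
    (rho : UMagmaMorphism.type (U1C R) (U1C R)) (tau : R[i] -> R[i]) :
  ((forall (g : U1C R) (z : R[i]), tau (act g z) = act (rho g) (tau z)) <->
   (exists2 beta : R[i], Xi rho beta &
      forall z : R[i], tau z = act (rho (transl z)) beta))
  /\
  (forall beta : R[i], Xi rho beta ->
     (forall z : R[i], tau z = act (rho (transl z)) beta) -> tau 0 = beta).
Proof.
split; last first.
  (* The translation by 0 fixes 0, so its image under [rho] fixes [beta]. *)
  by move=> beta /XiP Xib tauE; rewrite tauE; apply/Xib/act_transl0.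
split=> [tauM|[beta Xib tauE] g z].
  exists (tau 0) => [|z]; last by rewrite -tauM act_transl0.
  by apply/XiP => g g0; rewrite -tauM g0.
rewrite !tauE -actM -gmulfM; apply: act_eq_Xi => //.
by rewrite actM !act_transl0.
Qed.
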